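(* Let $n \in \mathbb{Z}_{\ge 1}$, let $K$ be a compact subset of $\mathbb{R}^n$ with non-empty interior, and let $d \in \mathbb{Z}_{\ge 3}$. Then there exists a polynomial $f \in P_n$ of degree $2d$ that satisfies $$\inf_{g \in C_n} \| f - g \|_K > 0.$$ Moreover, one can choose $f$ to be a square of a polynomial of degree $d$ from $\mathbb{R}[x_1,\ldots,x_n]$. Here $P_n$ is the cone of polynomials that are non-negative on $\mathbb{R}^n$, $C_n$ is the cone of SONC polynomials in $n$ variables, and $\|f\|_K := \max_{x \in K} |f(x)|$.
   Context: Let $\mathbb{R}[\mathbf{x}] := \mathbb{R}[x_1,\ldots,x_n]$ be the algebra of real polynomials in $n \ge 1$ variables. For $\alpha = (\alpha_1,\ldots,\alpha_n) \in \mathbb{Z}_{\ge 0}^n$ write $\mathbf{x}^{\alpha} := x_1^{\alpha_1}\cdots x_n^{\alpha_n}$. Degree means total degree. The support $\operatorname{supp} f$ of $f \in \mathbb{R}[\mathbf{x}]$ is the set of all exponent vectors $\alpha \in \mathbb{Z}_{\ge 0}^n$ such that $\mathbf{x}^{\alpha}$ occurs in $f$ with a non-zero coefficient. A circuit polynomial is a polynomial $f \in \mathbb{R}[\mathbf{x}]$ whose support satisfies $A \subseteq \operatorname{supp} f \subseteq A \cup \{\beta\}$ for some (non-empty) affinely independent subset $A$ of $2\mathbb{Z}_{\ge 0}^n$ (vectors all of whose entries are even non-negative integers) and some exponent vector $\beta \in \mathbb{Z}_{\ge 0}^n$ in the relative interior of the convex hull of $A$, such that the coefficients of $f$ for the monomials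 $\mathbf{x}^{\alpha}$ with $\alpha \in A$ are positive. The special case $A = \{\beta\}$ is allowed and corresponds to a degenerate circuit polynomial with only one term. A non-negative circuit polynomial is a circuit polynomial that is non-negative on $\mathbb{R}^n$. A SONC polynomial is a sum of finitely many non-negative circuit polynomials. Define $$P_n := \{ f \in \mathbb{R}[\mathbf{x}] : f \ge 0 \text{ on } \mathbb{R}^n \}, \qquad C_n := \{ f \in \mathbb{R}[\mathbf{x}] : f \text{ is a SONC polynomial} \}.$$ For a compact set $K \subseteq \mathbb{R}^n$ with non-empty interior, $\|f\|_K := \max_{x \in K} |f(x)|$, which is a norm on $\mathbb{R}[\mathbf{x}]$. *)

(* Defs.v *)
From HB Require Import structures.
From mathcomp Require Import all_boot all_order all_algebra.
From mathcomp Require Import finmap.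
From mathcomp Require Import all_classical all_reals all_analysis.
(* The notations of mpoly clash with those of mathcomp-analysis, so they are
   left out: [mpoly n R] is {mpoly R[n]}, [multinom n] is 'X_{1..n},
   [mcoeff m p] is p@_m and [meval v p] is p.@[v]. *)
From mathcomp.multinomials Require mpoly.
Export -(notations) mpoly.

Set Implicit Arguments.
Unset Strict Implicit.
Unset Printing Implicit Defensive.

Import Order.TTheory GRing.Theory Num.Theory.
Import numFieldNormedType.Exports.

Local Open Scope classical_set_scope.
Local Open Scope ring_scope.

Section Convexity.
Context {R : realType} {n : nat}.
Implicit Types S : set 'rV[R]_n.

Definition conv_hull S : set 'rV[R]_n :=
  smallest (fun A : set (convex_lmodType 'rV[R]_n) => convex_set A) S.

Definition affine_set S : Prop :=
  forall (t : R) (x y : 'rV[R]_n), S x -> S y -> S (t *: x + (1 - t) *: y).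

Definition aff_hull S : set 'rV[R]_n := smallest affine_set S.

(* Interior relative to the affine hull; [x] itself lies in [S], since it
   belongs to each of its neighbourhoods. *)
Definition relint S : set 'rV[R]_n :=
  [set x | aff_hull S x /\ \forall y \near x, aff_hull S y -> S y].

End Convexity.

Section Circuits.
Context {R : realType} {n : nat}.
Implicit Types (f g : mpoly n R) (A : {fset multinom n}).

Definition peval f (x : 'rV[R]_n) : R := meval (fun i => x ord0 i) f.

Definition expvec (m : multinom n) : 'rV[R]_n := \row_i (m i)%:R.

Definition aff_indep A : Prop :=
  forall c : multinom n -> R,
    \sum_(a <- A) c a = 0 -> \sum_(a <- A) c a *: expvec a = 0 ->
    forall a, a \in A -> c a = 0.

(* No generality is lost by taking [A] finite: [A] is contained in the
   support of [f]. *)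
Definition circuit_poly f : Prop :=
  exists (A : {fset multinom n}) (b : multinom n),
    [/\ A != fset0, aff_indep A & forall a, a \in A -> forall i, ~~ odd (a i)] /\
    relint (conv_hull (expvec @` [set` A])) (expvec b) /\
    [/\ {subset A <= msupp f}, {subset msupp f <= (b |` A)%fset}
      & forall a, a \in A -> 0 < mcoeff a f].

Definition nonneg_polys : set (mpoly n R) :=
  [set f | forall x : 'rV[R]_n, 0 <= peval f x].

Definition sonc_polys : set (mpoly n R) :=
  [set f | exists s : seq (mpoly n R),
    (forall g, g \in s -> circuit_poly g /\ nonneg_polys g) /\
    f = \sum_(g <- s) g].

(* For compact nonempty [K] the supremum is attained. *)
Definition norm_on (K : set 'rV[R]_n) f : R :=
  sup [set `|peval f x| | x in K].

End Circuits.

(* [msize] is the total degree plus one, and 0 for the zero polynomial. *)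
Definition has_degree (R : realType) (n : nat) (f : mpoly n R) (k : nat) : Prop :=
  msize f = k.+1.

(* Main.v *)
Require Import Defs.
From mathcomp Require Import all_boot all_order all_algebra.
From mathcomp Require Import all_classical all_reals all_analysis.
From mathcomp Require Import ring lra.
Import Order.TTheory GRing.Theory Num.Theory.
Import numFieldNormedType.Exports.

Local Open Scope classical_set_scope.
Local Open Scope ring_scope.

(** Some functional that is continuous for the norm on K separates a square
    from the cone of SONC polynomials.  Take three points of K on a line
    parallel to the first axis, with first coordinates a > b > c > 0 in
    arithmetic progression (or their opposites, which only changes the signs of
    odd powers).  On the k-th power of the first variable the functional
      L(g) = 5 (g(a) + g(b)) - g(c)
    takes the value y_k = 5 (a^k + b^k) - c^k.  This sequence is positive and
    log-convex ([three_point_log_convex]): two positive exponentials have a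
    log-convex sum, and the smaller exponential c^k is too small to spoil it.

    Log-convexity makes L nonnegative on nonnegative circuit polynomials
    ([circuit_three_point]).  Let l be the degree, in the first variable, of
    the only monomial whose coefficient may be negative.  The tangent at l
    ([log_convex_tangent]) is a geometric sequence y_l r^(k-l) which lies below
    y_k and meets it at k = l.  All the other coefficients are nonnegative, so
    L(g) is at least the same combination of the values y_l r^(k-l), which is
    a positive multiple of the value of g at first coordinate r.  Hence
    g(c) <= 5 (g(a) + g(b)) for every SONC polynomial g.

    The square f of (x - a)(x - b) x^(d-2), where x is the first variable, has
    f(a) = f(b) = 0 < f(c).  A SONC polynomial at distance N from f on K is at
    most N at a and b, so f(c) - N <= g(c) <= 10 N, and N >= f(c) / 11. *)

(** * Log-convex sequences *)

(** The slope r is y_(l+1) / y_l: log-convexity says that the ratios of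
    consecutive terms are nondecreasing, so y grows at least as fast as r^k
    after l and at most as fast before l.  The inequality is y_k >= y_l r^(k-l)
    with denominators cleared, so that k may be smaller than l. *)
Lemma log_convex_tangent {F : realFieldType} {y : nat -> F} :
    (forall k, 0 < y k) -> (forall k, y k.+1 ^+ 2 <= y k * y k.+2) ->
  forall l, exists2 r, 0 < r & forall k, y l * r ^+ k <= y k * r ^+ l.
Proof.
move=> y_gt0 y_lc.
pose rho k := y k.+1 / y k.
have rhoE k : y k.+1 = rho k * y k by rewrite /rho divfK ?gt_eqF.
have rho_gt0 k : 0 < rho k by rewrite divr_gt0.
have rho_ge0 k : 0 <= rho k := ltW (rho_gt0 k).
have y_ge0 k : 0 <= y k := ltW (y_gt0 k).
have rhoS k : rho k <= rho k.+1.
  by rewrite /rho ler_pdivrMr // mulrAC ler_pdivlMr // -expr2 mulrC.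
clearbody rho.
have rho_le k j : rho k <= rho (k + j)%N.
  by elim: j => [|j IH]; rewrite ?addn0 // addnS (le_trans IH).
have up l j : y l * rho l ^+ j <= y (l + j)%N.
  elim: j => [|j IH]; first by rewrite addn0 mulr1.
  by rewrite addnS rhoE exprS mulrCA; apply: ler_pM;
     rewrite ?mulr_ge0 ?exprn_ge0 ?rho_le.
have down k r j : rho (k + j)%N <= r -> y (k + j)%N <= y k * r ^+ j.
  elim: j => [_|j IH le_r]; first by rewrite addn0 mulr1.
  have le_r' : rho (k + j)%N <= r by rewrite (le_trans _ le_r) // addnS.
  by rewrite addnS rhoE exprS mulrCA ler_pM ?IH // (le_trans (rho_le k j)).
move=> l; exists (rho l) => // k; case: (leqP l k) => [/subnKC <-|/ltnW].
  by rewrite exprD mulrCA mulrC ler_pM2r ?exprn_gt0.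
move=> /subnKC; move: (l - k)%N => j <-.
by rewrite exprD mulrCA mulrC ler_pM2l ?exprn_gt0 // down.
Qed.

Section ThreePoints.
Context {F : realFieldType} (a b c : F).
Hypotheses (c_gt0 : 0 < c) (cb : c < b) (ba : b < a).
Hypothesis spread : (a - c) ^+ 2 + (b - c) ^+ 2 <= 5 * (a - b) ^+ 2.

Definition three_point (k : nat) : F := 5 * (a ^+ k + b ^+ k) - c ^+ k.

Lemma three_point_gt0 k : 0 < three_point k.
Proof.
have b_gt0 := lt_trans c_gt0 cb; have a_gt0 := lt_trans b_gt0 ba.
have ca : c ^+ k <= a ^+ k by rewrite lerXn2r ?nnegrE ?ltW // (lt_trans cb).
have := exprn_gt0 k a_gt0; have := exprn_gt0 k b_gt0.
by rewrite /three_point; lra.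
Qed.

(** The determinant y_k y_(k+2) - y_(k+1)^2 is the sum over the pairs of points
    of the products of their weights, times the square of their distance, times
    the k-th power of their product.  Only the two pairs containing c count
    negatively; their powers are at most (a b)^k, and the spread hypothesis
    bounds their squared distances by that of a and b. *)
Lemma three_point_log_convex k :
  three_point k.+1 ^+ 2 <= three_point k * three_point k.+2.
Proof.
have b_gt0 := lt_trans c_gt0 cb; have a_gt0 := lt_trans b_gt0 ba.
rewrite /three_point !(exprS _ k.+1) !(exprS _ k).
have ca : c ^+ k <= a ^+ k by rewrite lerXn2r ?nnegrE ?ltW // (lt_trans cb).
have cb' : c ^+ k <= b ^+ k by rewrite lerXn2r ?nnegrE ?ltW.
have := exprn_gt0 k a_gt0; have := exprn_gt0 k b_gt0.
move: (a ^+ k) (b ^+ k) (c ^+ k) ca cb' => A B C CA CB B0 A0.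
rewrite -subr_ge0.
suff -> : (5 * (A + B) - C) * (5 * (a * (a * A) + b * (b * B)) - c * (c * C))
        - (5 * (a * A + b * B) - c * C) ^+ 2
    = 5 * (A * B * (5 * (a - b) ^+ 2 - ((a - c) ^+ 2 + (b - c) ^+ 2))
           + A * (B - C) * (a - c) ^+ 2 + B * (A - C) * (b - c) ^+ 2).
  have [A_ge0 B_ge0] : 0 <= A /\ 0 <= B by split; exact: ltW.
  apply: mulr_ge0 => //; apply: addr_ge0; first apply: addr_ge0.
  - by apply: mulr_ge0; [exact: mulr_ge0 | rewrite subr_ge0].
  - by apply: mulr_ge0; [apply: mulr_ge0; rewrite ?subr_ge0 | exact: sqr_ge0].
  - by apply: mulr_ge0; [apply: mulr_ge0; rewrite ?subr_ge0 | exact: sqr_ge0].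
by ring.
Qed.

End ThreePoints.

(** A polynomial with at most one term l of arbitrary sign or parity is
    compared with its own value at sg * r, where r is the tangent slope at
    e l.  The two sides agree at l, and at the other terms the tangent lies
    below y.  The sign sg = 1 or -1 allows points on the negative axis; it
    disappears from every even power. *)
Lemma log_convex_pairing_ge0 {F : realFieldType} {I : eqType} (s : seq I)
    (l : I) (W : I -> F) (e : I -> nat) (y : nat -> F) (sg : F) :
    (forall k, 0 < y k) -> (forall k, y k.+1 ^+ 2 <= y k * y k.+2) ->
    (forall i, i \in s -> i != l -> 0 <= W i /\ ~~ odd (e i)) ->
    (forall t, 0 <= \sum_(i <- s) W i * t ^+ e i) -> sg ^+ 2 = 1 ->
  0 <= \sum_(i <- s) W i * (sg ^+ e i * y (e i)).
Proof.
move=> y_gt0 y_lc W_ge0 h_ge0 sg2.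
have [r r_gt0 tangent] := log_convex_tangent y_gt0 y_lc (e l).
rewrite -(pmulr_rge0 _ (exprn_gt0 (e l) r_gt0)) mulr_sumr.
apply: le_trans (mulr_ge0 (ltW (y_gt0 (e l))) (h_ge0 (sg * r))) _.
rewrite mulr_sumr big_seq [leRHS]big_seq; apply: ler_sum => i i_s.
have [->|il] := eqVneq i l.
  by rewrite exprMn le_eqVlt; apply/orP; left; apply/eqP; ring.
have [Wi ei] := W_ge0 i i_s il.
have sgE : sg ^+ e i = 1.
  by rewrite -(odd_double_half (e i)) (negbTE ei) -mul2n exprM sg2 expr1n.
rewrite exprMn sgE !mul1r mulrCA [leRHS]mulrCA ler_wpM2l //.
by rewrite [leRHS]mulrC.
Qed.

(** * The three-point inequality for SONC polynomials *)

Section Lines.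
Context {R : realType} {n : nat}.
Implicit Types (f g : mpoly n R) (p : 'rV[R]_n) (i : 'I_n).

Definition set_coord p i (t : R) : 'rV[R]_n :=
  \row_j (if j == i then t else p ord0 j).

Lemma peval_set_coord g p i t :
  peval g (set_coord p i t) = \sum_(m <- msupp g)
    (mcoeff m g * \prod_(j | j != i) p ord0 j ^+ m j) * t ^+ m i.
Proof.
rewrite /peval mevalE; apply: eq_bigr => m _.
rewrite (bigD1 i) //= mxE eqxx mulrCA mulrC; congr (_ * _ * _).
by apply: eq_bigr => j /negbTE ji; rewrite mxE ji.
Qed.

Section Inequality.
Variables (p : 'rV[R]_n) (i : 'I_n) (a b c sg : R).
Hypotheses (c_gt0 : 0 < c) (cb : c < b) (ba : b < a).
Hypothesis spread : (a - c) ^+ 2 + (b - c) ^+ 2 <= 5 * (a - b) ^+ 2.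
Hypothesis sg2 : sg ^+ 2 = 1.

Local Notation at_ g t := (peval g (set_coord p i (sg * t))).

(** On the line, the monomial m contributes its coefficient times the powers of
    the other coordinates of p.  For the monomials in A this weight is
    nonnegative whatever p is, because the exponents are even; so only the
    monomial l may have a negative weight. *)
Lemma circuit_three_point g : circuit_poly g -> nonneg_polys g ->
  at_ g c <= 5 * (at_ g a + at_ g b).
Proof.
move=> [A [l [[_ _ A_even] [_ [_ supp_g A_pos]]]]] g_ge0.
rewrite -subr_ge0 !peval_set_coord -big_split /= mulr_sumr -sumrB.
pose W (m : multinom n) := mcoeff m g * \prod_(j | j != i) p ord0 j ^+ m j.
have -> : \sum_(m <- msupp g)
    (5 * (W m * (sg * a) ^+ m i + W m * (sg * b) ^+ m i) - W m * (sg * c) ^+ m i)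
  = \sum_(m <- msupp g) W m * (sg ^+ m i * three_point a b c (m i)).
  by apply: eq_bigr => m _; rewrite !exprMn /three_point; ring.
apply: (@log_convex_pairing_ge0 _ _ _ l W (fun m => m i)) => //.
- by move=> k; exact: three_point_gt0.
- by move=> k; exact: three_point_log_convex.
- move=> m m_g ml.
  have := supp_g m m_g; rewrite finmap.in_fset1U (negbTE ml) /= => mA.
  split; last exact: A_even.
  rewrite mulr_ge0 ?(ltW (A_pos m mA)) // prodr_ge0 // => j _.
  by rewrite exprn_even_ge0 // A_even.
- by move=> t; rewrite -peval_set_coord; exact: g_ge0.
Qed.

Lemma sonc_three_point g : sonc_polys g ->
  at_ g c <= 5 * (at_ g a + at_ g b).
Proof.
move=> [s [circ_s ->]].
have atE t : at_ (\sum_(h <- s) h) t = \sum_(h <- s) at_ h t.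
  exact: raddf_sum.
rewrite !atE -big_split /= mulr_sumr big_seq [leRHS]big_seq.
apply: ler_sum => h /circ_s[circ_h h_ge0].
exact: circuit_three_point.
Qed.

End Inequality.

(** * Polynomials on a compact set *)

Lemma peval_continuous f : continuous (peval f).
Proof.
have -> : peval f = fun x => \sum_(m <- msupp f) mcoeff m f *
    \prod_j x ord0 j ^+ m j by apply/funext => x; rewrite /peval mevalE.
apply: continuous_big => [|m _]; first exact: add_continuous.
move=> x; apply: continuousM; first exact: cst_continuous.
apply: (@continuous_big _ _ _ _ _ (@mul_continuous R)) => j _ z.
apply: (@continuous_comp _ _ _ (fun u : 'rV[R]_n => u ord0 j)
  (fun t : R => t ^+ m j)); first exact: coord_continuous.
exact: exprn_continuous.
Qed.

(** Compactness is needed for the values on K to be bounded: [sup] of an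
    unbounded set is 0. *)
Lemma le_norm_on (K : set 'rV[R]_n) f x : compact K -> K x ->
  `|peval f x| <= norm_on K f.
Proof.
move=> cK Kx; apply: ub_le_sup; last by exists x.
have cfK : compact [set `|peval f z| | z in K].
  apply: continuous_compact => //; apply: continuous_subspaceT => z.
  apply: continuous_comp; first exact: peval_continuous.
  exact: norm_continuous.
by case: (@compact_has_sup R _ _ cfK) => //; exists `|peval f x|, x.
Qed.

Lemma interior_set_coord (K : set 'rV[R]_n) p i : interior K p ->
  exists2 e, 0 < e & forall t, `|p ord0 i - t| < e -> K (set_coord p i t).
Proof.
move=> /nbhs_ballP[e /= e_gt0 sub]; exists e => // t pt; apply: sub.
split=> // k j; rewrite ord1 mxE; case: eqP => [->//|_]; exact: ballxx.
Qed.

(** * Degrees *)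

Definition linear_factor i (t : R) : mpoly n R := mpolyX R (mnm1 i) - mpolyC n t.

Lemma msize_linear_factor i t : msize (linear_factor i t) = 2%N.
Proof.
apply/eqP; rewrite eqn_leq; apply/andP; split.
  rewrite (leq_trans (msizeD_le _ _)) // msizeN msizeX mdeg1 msizeC.
  by rewrite geq_max /=; case: (_ == _).
(* The monomial of the variable has coefficient 1. *)
rewrite -[X in (X < _)%N](mdeg1 i) msize_mdeg_lt //.
rewrite mcoeff_msupp mcoeffB mcoeffXU mcoeffC mnm1_eq0 eqxx.
by rewrite mulr0 subr0 oner_eq0.
Qed.

Lemma peval_linear_factor i t x : peval (linear_factor i t) x = x ord0 i - t.
Proof. by rewrite /peval mevalB mevalXU mevalC. Qed.

Lemma msizeXn g k : g != 0 -> msize (g ^+ k) = ((msize g).-1 * k).+1.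
Proof.
move=> g0; elim: k => [|k IH]; first by rewrite expr0 msize1 muln0.
rewrite exprS msizeM ?expf_neq0 // IH addnS /= mulnS.
rewrite -[in LHS](prednK (n := msize g)) //.
by rewrite lt0n msize_poly_eq0.
Qed.

End Lines.

Theorem mainTheorem1 (R : realType) (n : nat) (hn : (1 <= n)%N)
  (K : set 'rV[R]_n) (hK : compact K) (hKi : interior K !=set0)
  (d : nat) (hd : (3 <= d)%N) :
  exists f : mpoly n R,
    [/\ f \in nonneg_polys,
        has_degree f (2 * d),
        0 < inf [set norm_on K (f - g) | g in sonc_polys]
      & exists q : mpoly n R, has_degree q d /\ f = q ^+ 2].
Proof.
have [p Kp] := hKi; pose i := Ordinal hn.
have [e e_gt0 Kline] := interior_set_coord _ _ i Kp.
(* The points move away from the hyperplane u = 0 so that their first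
   coordinates are nonzero and have the same sign, even if u = 0. *)
pose u := p ord0 i; pose sg : R := if 0 <= u then 1 else -1.
have sg2 : sg ^+ 2 = 1 by rewrite /sg; case: ifP => _; ring.
have uE : u = sg * `|u|.
  by rewrite /sg; case: ger0P => _; ring.
pose x (k : R) := `|u| + e * k / 4.
have x1_gt0 : 0 < x 1 by rewrite /x; have := normr_ge0 u; lra.
have x12 : x 1 < x 2 by rewrite /x; lra.
have x23 : x 2 < x 3 by rewrite /x; lra.
have spread : (x 3 - x 1) ^+ 2 + (x 2 - x 1) ^+ 2 <= 5 * (x 3 - x 2) ^+ 2.
  by rewrite /x le_eqVlt; apply/orP; left; apply/eqP; field.
pose v k := set_coord p i (sg * x k).
have Kv (k : R) : 0 < k < 4 -> K (v k).
  move=> k4; apply: Kline; rewrite -/u {1}uE /x.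
  have -> : sg * `|u| - sg * (`|u| + e * k / 4) = - (sg * (e * k / 4)) by ring.
  have sg1 : `|sg| = 1 by rewrite /sg; case: ifP => _; rewrite ?normrN normr1.
  rewrite normrN normrM sg1 mul1r ger0_norm; nra.
(* The last factor only raises the degree to d; it does not vanish at v 1. *)
pose lf (t : R) : mpoly n R := linear_factor i t.
pose q : mpoly n R := lf (sg * x 3) * lf (sg * x 2) * lf 0 ^+ (d - 2).
have lf0 t : lf t != 0 by rewrite -msize_poly_eq0 msize_linear_factor.
have q0 : q != 0 by rewrite !mulf_neq0 ?expf_neq0.
have qdeg : msize q = d.+1.
  rewrite !msizeM ?mulf_neq0 ?expf_neq0 // msizeXn // !msize_linear_factor /=.
  by rewrite mul1n addnS /= (subnKC (ltnW hd)).
have qv k : peval q (v k) =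
    sg * (x k - x 3) * (sg * (x k - x 2)) * (sg * x k) ^+ (d - 2).
  rewrite /peval !mevalM rmorphXn /= -!/(peval _ _) !peval_linear_factor.
  by rewrite mxE eqxx subr0 !mulrBr.
have fE z : peval (q ^+ 2) z = peval q z ^+ 2 by rewrite /peval rmorphXn.
have fv1 : 0 < peval (q ^+ 2) (v 1).
  have sg0 : sg != 0 by rewrite -sqrf_eq0 sg2 oner_eq0.
  rewrite fE exprn_even_gt0 //= qv !mulf_neq0 ?expf_neq0 ?mulf_neq0 //.
  - by rewrite subr_eq0 lt_eqF // (lt_trans x12).
  - by rewrite subr_eq0 lt_eqF.
  - by rewrite gt_eqF.
have fv2 : peval (q ^+ 2) (v 2) = 0 by rewrite fE qv subrr; ring.
have fv3 : peval (q ^+ 2) (v 3) = 0 by rewrite fE qv subrr; ring.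
exists (q ^+ 2); split.
- by rewrite inE => z /=; rewrite fE sqr_ge0.
- by rewrite /has_degree msizeXn // qdeg mulnC.
- (* With N the norm: f(v 1) - N <= g(v 1) <= 5 (g(v 3) + g(v 2)) <= 10 N. *)
  apply: (@lt_le_trans _ _ (peval (q ^+ 2) (v 1) / 11)); first by rewrite divr_gt0.
  apply: lb_le_inf.
    by exists (norm_on K (q ^+ 2 - 0)), 0 => //; exists [::]; rewrite big_nil.
  move=> _ [g g_sonc <-].
  have := sonc_three_point p i _ _ _ _ x1_gt0 x12 x23 spread sg2 _ g_sonc.
  rewrite -![set_coord _ _ _]/(v _).
  have close k : 0 < k < 4 ->
      `|peval (q ^+ 2) (v k) - peval g (v k)| <= norm_on K (q ^+ 2 - g).
    by move=> /Kv /(le_norm_on K (q ^+ 2 - g) _ hK); rewrite /peval mevalB.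
  have := close 1 ltac:(lra); have := close 2 ltac:(lra).
  have := close 3 ltac:(lra).
  by rewrite fv2 fv3 !ler_norml => /andP[c3 _] /andP[c2 _] /andP[_ c1]; lra.
- by exists q.
Qed.
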